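(* $\mathrm{Swath}(n-1)$ equals the central path: $$\mathrm{Swath}(n-1)=\{x(\eta):\eta>0\},$$ where, for those $\eta>0$ for which a minimizer exists, $x(\eta)$ denotes the minimizer of $\eta\, c^*x-\ln p(x)$ over $\{x\in\Lambda_{++}: Ax=b\}$ (and the right-hand side consists of all the minimizers that exist).
   Context: $\mathcal{E}$ is a finite-dimensional Euclidean space. $p:\mathcal{E}\to\mathbb{R}$ is a homogeneous polynomial of degree $n$ that is hyperbolic in some direction $e_0$: $p(e_0)>0$ and for every $x$ all roots of $t\mapsto p(x+te_0)$ are real. $\Lambda_{++}$ is the connected component of $\{p>0\}$ containing $e_0$, and $\Lambda_+$ is its closure. Known (Gårding): $\Lambda_{++}$ is convex and $p$ is hyperbolic in every direction $e\in\Lambda_{++}$. For $e\in\Lambda_{++}$ and $0\le i\le n-1$, $p_e^{(i)}(x):=D^ip(x)[e,\dots,e]$ ($i$ copies of $e$; $p_e^{(0)}=p$), which is hyperbolic in direction $e$ of degree $n-i$; $\Lambda^{(i)}_{++,e}$ is the connected component of $\{p_e^{(i)}>0\}$ containing $e$, and $\Lambda^{(i)}_{+,e}$ its closure. Standing assumptions: $\Lambda_+$ is regular (nonempty interior, contains no linear subspace other than $\{0\}$); $A:\mathcal{E}\to\mathbb{R}^m$ is linear and surjective; $0\ne b\in\mathbb{R}^m$; $c^*$ is a linear functional on $\mathcal{E}$ not in the image of $A^*$ (i.e. not of the form $y^*A$ with $y^*$ a linear functional on $\mathbb{R}^m$). $\mathrm{HP}^{(i)}_e$ is the problem of minimizing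 $c^*x$ subject to $Ax=b$, $x\in\Lambda^{(i)}_{+,e}$, and $\mathrm{Opt}^{(i)}_e$ is its set of optimal solutions (minimizers). For $0\le i\le n-1$, $\mathrm{Swath}(i):=\{e\in\Lambda_{++}: Ae=b \text{ and } \mathrm{Opt}^{(i)}_e\ne\emptyset\}$. *)

(* Defs.v *)
From HB Require Import structures.
From mathcomp Require Import all_boot all_order all_algebra.
From mathcomp Require Import all_classical all_reals all_analysis.
From mathcomp Require Import complex.
(* The notations of [mpoly] clash with those of MathComp-Analysis. *)
From mathcomp Require mpoly.
Import -(notations) mpoly.

Set Implicit Arguments.
Unset Strict Implicit.
Unset Printing Implicit Defensive.

Import Order.TTheory GRing.Theory Num.Theory.
Import numFieldNormedType.Exports.

Local Open Scope classical_set_scope.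
Local Open Scope ring_scope.

(* The Euclidean space is coordinatized as ['rV[R]_d]. *)

Definition polyfun (R : realType) (d : nat) (P : mpoly d R)
    (x : 'rV[R]_d) : R :=
  meval (fun j => x ord0 j) P.

(* The value of the polynomial at the complex point [x + z e]. *)
Definition polyfunC (R : realType) (d : nat) (P : mpoly d R)
    (x e : 'rV[R]_d) (z : R[i]) : R[i] :=
  meval
    (fun j => (real_complex R (x ord0 j) : R[i])
              + z * real_complex R (e ord0 j))
    (map_mpoly (real_complex R) P).

Definition homogeneous (R : realType) (d n : nat) (P : mpoly d R) : Prop :=
  P \is ishomog1 n (@mdeg d).

(* The roots of [t |-> p (x + t e)] are its complex roots. *)
Definition hyperbolic (R : realType) (d : nat) (P : mpoly d R)
    (e : 'rV[R]_d) : Prop :=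
  0 < polyfun P e /\
  forall (x : 'rV[R]_d) (z : R[i]),
    polyfunC P x e z = 0 -> Im z = 0.

(* [dirder i f e x] is [D^i f(x)[e, ..., e]], as an iterated directional
   derivative. *)
Definition dirder (R : realType) (d : nat) (i : nat) (f : 'rV[R]_d -> R)
    (e : 'rV[R]_d) : 'rV[R]_d -> R :=
  iter i (fun (g : 'rV[R]_d -> R) (x : 'rV[R]_d) => 'D_e g x) f.

Definition open_cone (R : realType) (d : nat) (f : 'rV[R]_d -> R)
    (e : 'rV[R]_d) : set 'rV[R]_d :=
  connected_component [set x | 0 < f x] e.

Definition closed_cone (R : realType) (d : nat) (f : 'rV[R]_d -> R)
    (e : 'rV[R]_d) : set 'rV[R]_d :=
  closure (open_cone f e).

Definition regular_cone (R : realType) (d : nat) (K : set 'rV[R]_d) : Prop :=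
  K° !=set0 /\
  forall V : {vspace 'rV[R]_d}, [set x | x \in V] `<=` K -> V = 0%VS.

Definition minimizers (R : realType) (T : Type) (f : T -> R) (F : set T) :
    set T :=
  [set x | F x /\ forall y, F y -> f x <= f y].

Section Swath.
Context (R : realType) (d m : nat).
Variables (P : mpoly d R) (e0 : 'rV[R]_d).
Variables (A : {linear 'rV[R]_d -> 'rV[R]_m}) (b : 'rV[R]_m).
Variable c : {scalar 'rV[R]_d}.

Definition Opt (i : nat) (e : 'rV[R]_d) : set 'rV[R]_d :=
  minimizers c
    [set x | A x = b /\ closed_cone (dirder i (polyfun P) e) e x].

Definition Swath (i : nat) : set 'rV[R]_d :=
  [set e | [/\ open_cone (polyfun P) e0 e, A e = b & Opt i e !=set0]].

(* The set of all candidates for [x(eta)], empty when no minimizer exists. *)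
Definition central_point (eta : R) : set 'rV[R]_d :=
  minimizers (fun x => eta * c x - ln (polyfun P x))
    [set x | open_cone (polyfun P) e0 x /\ A x = b].

End Swath.

(* Main.v *)
(* [p_e^(n-1)] is [(n-1)!] times the linear form [Dp(e)], so [HP^(n-1)_e]
   minimizes [c] over a half-space slice of [{A x = b}]; it has a solution iff
   [c] is a positive multiple of [Dp(e)] on [ker A].  On the other side,
   [eta c - D(ln p)(e)] vanishes on [ker A] exactly at the minimizers of
   [eta c - ln p], because [ln p] is concave on the cone.  With
   [D(ln p)(e) = Dp(e) / p(e)] both conditions agree.

   Concavity comes from Garding's theorem: for [e] and [x] in the cone,
   [p(x + t e) = p(e) (t + r_1) ... (t + r_n)] with all [r_i > 0], so that
   [ln p(x) - ln p(e)] is the sum of the [ln r_i] and [D(ln p)(e)[x - e]] that of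
   the [r_i - 1].  Equality forces [r_i = 1] for all [i]; then [p] is constant on
   the line through [e] and [x], whose direction lies in the closed cone, so
   [x = e] by regularity. *)
Require Import Defs.
From HB Require Import structures.
From mathcomp Require Import all_boot all_order all_algebra.
From mathcomp Require Import all_classical all_reals all_analysis.
From mathcomp Require Import complex.
From mathcomp Require Import zify ring lra.
From mathcomp Require mpoly.
Import -(notations) mpoly.

Set Implicit Arguments.
Unset Strict Implicit.
Unset Printing Implicit Defensive.

Import Order.TTheory GRing.Theory Num.Theory.
Import numFieldNormedType.Exports.

Local Open Scope classical_set_scope.
Local Open Scope ring_scope.

(** * Restriction of a polynomial to a line *)

(** Points are families over an arbitrary ring, so that one construction serves the real polynomial
    and its complexification at complex base points. *)
Definition linepoly (K : comNzRingType) (d : nat) (Q : mpoly d K)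
    (u v : 'I_d -> K) : {poly K} :=
  mmap polyC (fun j => (u j)%:P + (v j)%:P * 'X) Q.

Lemma horner_linepoly (K : comNzRingType) (d : nat) (Q : mpoly d K)
    (u v : 'I_d -> K) (t : K) :
  (linepoly Q u v).[t] = meval (fun j => u j + v j * t) Q.
Proof.
rewrite /linepoly /mmap mevalE horner_sum; apply: eq_bigr => k _.
rewrite hornerM hornerC /mmap1 horner_prod; congr (_ * _).
by apply: eq_bigr => j _; rewrite horner_exp !hornerE.
Qed.

Lemma meval_homog (K : comNzRingType) (d n : nat) (Q : mpoly d K) :
  Q \is ishomog1 n (@mdeg d) -> forall (a : K) (u : 'I_d -> K),
  meval (fun j => a * u j) Q = a ^+ n * meval u Q.
Proof.
move=> /dhomogP hQ a u; rewrite !mevalE mulr_sumr [LHS]big_seq [RHS]big_seq.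
apply: eq_bigr => k /hQ /= hk.
rewrite mulrCA; congr (_ * _).
under eq_bigr do rewrite exprMn.
by rewrite big_split /= -hk mdegE expr_sum.
Qed.

Lemma size_linepoly (K : comNzRingType) (d n : nat) (Q : mpoly d K) :
  Q \is ishomog1 n (@mdeg d) -> forall u v : 'I_d -> K,
  (size (linepoly Q u v) <= n.+1)%N.
Proof.
move=> /dhomogP hQ u v; rewrite /linepoly /mmap big_seq.
apply: (big_ind (fun p : {poly K} => size p <= n.+1)%N).
- by rewrite size_poly0.
- by move=> p q hp hq; apply: leq_trans (size_polyD _ _) _; rewrite geq_max hp.
move=> k /hQ /= <-; rewrite mdegE.
rewrite mul_polyC; apply: leq_trans (size_scale_leq _ _) _.
rewrite /mmap1.
apply: (big_ind2 (fun (p : {poly K}) (s : nat) => size p <= s.+1)%N).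
- by rewrite size_poly1.
- move=> p a q b hp hq; apply: leq_trans (size_polyMleq _ _) _; lia.
move=> j _; apply: leq_trans (size_poly_exp_leq _ _) _; rewrite ltnS.
rewrite -[X in (_ <= X)%N]mul1n leq_mul2r; apply/orP; right.
suff: (size ((u j)%:P + (v j)%:P * 'X)%R <= 2)%N by lia.
rewrite addrC size_MXaddC; case: ifP => // _.
by rewrite ltnS size_polyC; case: (v j != 0).
Qed.

(** By homogeneity [Q (u + t v) = t^n Q (v + t^-1 u)] for nonzero [t], so swapping base point and
    direction reverses the coefficients. *)
Lemma linepoly_rev (K : numFieldType) (d n : nat) (Q : mpoly d K) :
  Q \is ishomog1 n (@mdeg d) -> forall (u v : 'I_d -> K) (i : nat),
  (i <= n)%N -> (linepoly Q u v)`_i = (linepoly Q v u)`_(n - i).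
Proof.
move=> hQ u v i hi.
pose g := \poly_(i < n.+1) (linepoly Q v u)`_(n - i).
suff -> : linepoly Q u v = g by rewrite coef_poly ltnS hi.
apply/eqP; rewrite -subr_eq0; apply/eqP.
(* Both sides have size at most [n.+1], so agreement at the [n.+1] distinct nonzero points
   [1, ..., n.+1] is enough. *)
apply: (@roots_geq_poly_eq0 _ _ [seq k.+1%:R | k <- iota 0 n.+1]).
- apply/allP => _ /mapP[k _ ->]; rewrite rootE hornerD hornerN subr_eq0.
  have k0 : k.+1%:R != 0 :> K by rewrite pnatr_eq0.
  rewrite horner_poly horner_linepoly.
  have -> : meval (fun j => u j + v j * k.+1%:R) Q =
            k.+1%:R ^+ n * (linepoly Q v u).[k.+1%:R^-1].
    rewrite horner_linepoly -(meval_homog hQ); apply: meval_eq => j.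
    by rewrite mulrDr mulrCA mulfV// mulr1 addrC mulrC.
  rewrite (horner_coef_wide _ (size_linepoly hQ v u)) mulr_sumr.
  rewrite (reindex_inj rev_ord_inj) /=; apply/eqP/eq_bigr => j _.
  have hj := ltn_ord j; rewrite ltnS in hj.
  have -> : k.+1%:R ^+ n = k.+1%:R ^+ j * k.+1%:R ^+ (n - j) :> K.
    by rewrite -exprD subnKC.
  by rewrite subSS mulrCA -mulrA -exprMn mulfV// expr1n mulr1.
- rewrite map_inj_uniq ?iota_uniq// => a b /eqP.
  by rewrite eqr_nat eqSS => /eqP.
rewrite size_map size_iota; apply: leq_trans (size_polyD _ _) _.
by rewrite size_polyN geq_max size_linepoly// size_poly.
Qed.

Lemma lead_coef_linepoly (K : numFieldType) (d n : nat) (Q : mpoly d K) :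
  Q \is ishomog1 n (@mdeg d) -> forall u v : 'I_d -> K, meval v Q != 0 ->
  lead_coef (linepoly Q u v) = meval v Q /\ size (linepoly Q u v) = n.+1.
Proof.
move=> hQ u v hv.
have hc : (linepoly Q u v)`_n = meval v Q.
  rewrite (linepoly_rev hQ)// subnn -horner_coef0 horner_linepoly.
  by apply: meval_eq => j; rewrite mulr0 addr0.
have hs : size (linepoly Q u v) = n.+1.
  apply/eqP; rewrite eqn_leq size_linepoly//= ltnNge; apply/negP => h.
  by move: hv; rewrite -hc nth_default ?eqxx.
by rewrite /lead_coef hs.
Qed.

Lemma linepoly_factor (K : numClosedFieldType) (d n : nat) (Q : mpoly d K) :
  Q \is ishomog1 n (@mdeg d) -> forall u v : 'I_d -> K, meval v Q != 0 ->
  exists2 rs : seq K, size rs = n &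
    linepoly Q u v = meval v Q *: \prod_(r <- rs) ('X - r%:P).
Proof.
move=> hQ u v hv.
have [hl hs] := lead_coef_linepoly hQ u hv.
have [rs hrs] := closed_field_poly_normal (linepoly Q u v).
exists rs; last by rewrite {1}hrs hl.
move: hs; rewrite {1}hrs size_scale ?hl// size_prod_XsubC.
by case.
Qed.

(** * Uniform continuity of polynomials on bounded sets *)

(** An induction principle for polynomial functions of a parameter [t]; it yields the Lipschitz
    bounds below and, later, the linearity of the gradient. *)
Lemma mmap_fun_ind (K : nzRingType) (S : comNzRingType) (f : {rmorphism K -> S})
    (d : nat) (T : Type) (h : T -> 'I_d -> S) (Pr : (T -> S) -> Prop)
    (Q : mpoly d K) :
  (forall c, Pr (fun=> f c)) -> (forall j, Pr (h^~ j)) ->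
  (forall F G, Pr F -> Pr G -> Pr (fun t => F t + G t)) ->
  (forall F G, Pr F -> Pr G -> Pr (fun t => F t * G t)) ->
  Pr (fun t => mmap f (h t) Q).
Proof.
move=> hC hX hD hM; rewrite /mmap.
elim: (msupp Q) => [|k s ih].
  by under eq_fun do rewrite big_nil -(rmorph0 f).
under eq_fun do rewrite big_cons.
apply: (hD _ _ _ ih); apply: (hM (fun=> _)) => //; rewrite /mmap1.
elim: (index_enum _) => [|j r ihr].
  by under eq_fun do rewrite big_nil -(rmorph1 f).
under eq_fun do rewrite big_cons.
apply: (hM _ _ _ ihr); elim: (k j) => [|a iha].
  by under eq_fun do rewrite expr0 -(rmorph1 f).
under eq_fun do rewrite exprS.
exact: hM.
Qed.

(** The size bound and the Lipschitz bound are proved together, since the product case of the second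
    needs the first for both factors. *)
Lemma meval_lipschitz (K : numDomainType) (d : nat) (Q : mpoly d K) (B : K) :
  exists2 L : K, 0 <= L & forall u v : 'I_d -> K,
    (forall j, `|u j| <= B) -> (forall j, `|v j| <= B) ->
    `|meval u Q| <= L /\ forall delta, 0 <= delta ->
      (forall j, `|u j - v j| <= delta) ->
      `|meval u Q - meval v Q| <= L * delta.
Proof.
pose lip (f : ('I_d -> K) -> K) := exists2 L : K, 0 <= L &
  forall u v : 'I_d -> K,
    (forall j, `|u j| <= B) -> (forall j, `|v j| <= B) ->
    `|f u| <= L /\ forall delta, 0 <= delta ->
      (forall j, `|u j - v j| <= delta) -> `|f u - f v| <= L * delta.
have lipC a : lip (fun=> a).
  exists `|a| => // u v _ _; split => // delta h _.
  by rewrite subrr normr0 mulr_ge0.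
have lipX j : lip (fun u => u j).
  exists (`|B| + 1) => [|u v hu hv]; first by rewrite addr_ge0.
  have B0 : 0 <= B by apply: le_trans (normr_ge0 _) (hu j).
  rewrite (ger0_norm B0); split=> [|delta d0 /(_ j) h].
    by apply: le_trans (hu j) _; rewrite lerDl.
  by apply: le_trans h _; rewrite mulrDl mul1r lerDr mulr_ge0.
have lipD f g : lip f -> lip g -> lip (fun u => f u + g u).
  move=> [L L0 hL] [M M0 hM]; exists (L + M) => [|u v hu hv].
    by rewrite addr_ge0.
  have [h1 h2] := hL u v hu hv; have [h3 h4] := hM u v hu hv.
  split=> [|delta d0 h].
    by apply: le_trans (ler_normD _ _) _; rewrite lerD.
  rewrite opprD addrACA; apply: le_trans (ler_normD _ _) _.
  by rewrite mulrDl lerD ?h2 ?h4.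
have lipM f g : lip f -> lip g -> lip (fun u => f u * g u).
  move=> [L L0 hL] [M M0 hM]; exists (L * M + L * M) => [|u v hu hv].
    by rewrite addr_ge0 ?mulr_ge0.
  have [h1 h2] := hL u v hu hv; have [h3 h4] := hM u v hu hv.
  have [_ h5] := hL v u hv hu; have [h6 _] := hM v u hv hu.
  have LM : 0 <= L * M by rewrite mulr_ge0.
  split=> [|delta d0 h].
    by rewrite normrM; apply: le_trans (ler_pM _ _ h1 h3) _; rewrite ?lerDl.
  have -> : f u * g u - f v * g v = f u * (g u - g v) + (f u - f v) * g v.
    by ring.
  apply: le_trans (ler_normD _ _) _; rewrite !normrM mulrDl.
  rewrite lerD//.
    by rewrite -mulrA ler_pM ?h4.
  by rewrite mulrAC ler_pM ?h2.
suff [L L0 hL] : lip (fun u => meval u Q) by exists L.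
exact: (mmap_fun_ind (f := idfun)).
Qed.

Lemma meval_unif_continuous (K : numFieldType) (d : nat) (Q : mpoly d K)
    (B eps : K) : 0 <= B -> 0 < eps ->
  exists2 delta : K, 0 < delta <= 1 & forall u v : 'I_d -> K,
    (forall j, `|u j| <= B) -> (forall j, `|u j - v j| <= delta) ->
    `|meval u Q - meval v Q| < eps.
Proof.
move=> B0 e0; have [L L0 hL] := meval_lipschitz Q (B + 1).
have L1 : 0 < L + 1 by rewrite ltr_wpDl.
(* The radius [x / (1 + x)] lies below both [x] and [1]; it replaces a minimum, as the order of [K]
   may be partial. *)
pose x := eps / (L + 1); have x0 : 0 < x by rewrite divr_gt0.
have x1 : 0 < 1 + x by rewrite addr_gt0.
have d0 : 0 < x / (1 + x) by rewrite divr_gt0.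
have hd1 : x / (1 + x) <= 1 by rewrite ler_pdivrMr// mul1r lerDr.
exists (x / (1 + x)) => [|u v hu hv]; first by rewrite d0.
have hu' j : `|u j| <= B + 1 by apply: le_trans (hu j) _; rewrite lerDl.
have hv' j : `|v j| <= B + 1.
  rewrite -[v j](subKr (u j)); apply: le_trans (ler_normB _ _) _.
  by rewrite lerD//; apply: le_trans (hv j) hd1.
have [_ h] := hL u v hu' hv'.
apply: le_lt_trans (h _ (ltW d0) hv) _.
apply: (@le_lt_trans _ _ (L * x)).
  rewrite ler_wpM2l// ler_pdivrMr// mulrDr mulr1 lerDl.
  by rewrite mulr_ge0 ?ltW.
by rewrite /x mulrA ltr_pdivrMr// mulrC ltr_pM2l// ltrDl.
Qed.

Lemma family_bounded (K : numDomainType) (d : nat) (u : 'I_d -> K) :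
  exists2 B : K, 0 < B & forall j, `|u j| <= B.
Proof.
exists (1 + \sum_j `|u j|) => [|j].
  by rewrite ltr_wpDr// sumr_ge0.
rewrite (bigD1 j)//= addrCA lerDl addr_ge0// sumr_ge0//.
Qed.

Lemma root_linepoly (K : comNzRingType) (d : nat) (Q : mpoly d K)
    (u v : 'I_d -> K) (t : K) :
  root (linepoly Q u v) t = (meval (fun j => u j + v j * t) Q == 0).
Proof. by rewrite rootE horner_linepoly. Qed.

(** The value at [t] is [Q v] times the product of the [t - r] over the [n] roots; if all roots were
    at distance at least [eps], its modulus would be at least [|Q v| eps^n]. *)
Lemma linepoly_root_near (K : numClosedFieldType) (d n : nat) (Q : mpoly d K) :
  Q \is ishomog1 n (@mdeg d) -> forall (u v : 'I_d -> K) (t eps : K),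
  meval v Q != 0 -> 0 < eps ->
  `|meval (fun j => u j + v j * t) Q| < `|meval v Q| * eps ^+ n ->
  exists2 t' : K, root (linepoly Q u v) t' & `|t - t'| < eps.
Proof.
move=> hQ u v t eps hv e0; rewrite -horner_linepoly.
have [rs srs hrs] := linepoly_factor hQ u hv.
rewrite hrs hornerZ normrM ltr_pM2l ?normr_gt0// horner_prod normr_prod => h.
have [/hasP[r rrs hr]|/hasPn hn] := boolP (has (fun r => `|t - r| < eps) rs).
  by exists r => //; rewrite rootE hornerZ; apply/eqP;
    rewrite (eqP (_ : root _ _))// ?mulr0// root_prod_XsubC.
suff /(le_lt_trans)/(_ h) : eps ^+ n <= \prod_(r <- rs) `|('X - r%:P).[t]|.
  by rewrite ltxx.
rewrite -srs; elim: (rs) hn => [|r s ih] hn; first by rewrite big_nil.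
rewrite big_cons exprS ler_pM ?exprn_ge0 ?(ltW e0)//.
  have := hn r (mem_head _ _); rewrite hornerXsubC -real_leNgt//.
  exact: gtr0_real.
by apply: ih => y hy; apply: hn; rewrite inE hy orbT.
Qed.

(** * Continuity of roots *)

(** Every root survives a small perturbation of [u]: the perturbed polynomial is still small at [t],
    hence has a root nearby. *)
Lemma linepoly_root_lift (K : numClosedFieldType) (d n : nat) (Q : mpoly d K) :
  Q \is ishomog1 n (@mdeg d) -> forall (u v : 'I_d -> K) (t eps : K),
  meval v Q != 0 -> 0 < eps -> root (linepoly Q u v) t ->
  exists2 delta : K, 0 < delta & forall u' : 'I_d -> K,
    (forall j, `|u j - u' j| <= delta) ->
    exists2 t' : K, root (linepoly Q u' v) t' & `|t - t'| < eps.
Proof.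
move=> hQ u v t eps hv e0 ht.
have [B B0 hB] := family_bounded (fun j => u j + v j * t).
have h0 : 0 < `|meval v Q| * eps ^+ n by rewrite mulr_gt0 ?normr_gt0 ?exprn_gt0.
have [delta /andP[d0 _] hd] := meval_unif_continuous Q (ltW B0) h0.
exists delta => // u' hu'; apply: (linepoly_root_near hQ) => //.
have := hd _ (fun j => u' j + v j * t) hB.
move: ht; rewrite root_linepoly => /eqP ->; rewrite sub0r normrN; apply => j.
by rewrite opprD addrACA subrr addr0.
Qed.

(** Conversely, a perturbation creates no root far from the old ones. Here [t] varies with [u'], so
    the roots must first be bounded uniformly. *)
Lemma linepoly_root_proj (K : numClosedFieldType) (d n : nat) (Q : mpoly d K) :
  Q \is ishomog1 n (@mdeg d) -> forall (u v : 'I_d -> K) (eps : K),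
  meval v Q != 0 -> 0 < eps ->
  exists2 delta : K, 0 < delta & forall u' : 'I_d -> K,
    (forall j, `|u j - u' j| <= delta) ->
    forall t, root (linepoly Q u' v) t ->
    exists2 t' : K, root (linepoly Q u v) t' & `|t - t'| < eps.
Proof.
move=> hQ u v eps hv e0.
have [B B0 hB] := family_bounded u.
have [Bv Bv0 hBv] := family_bounded v.
have nv0 : 0 < `|meval v Q| by rewrite normr_gt0.
have [d1 /andP[d10 _] hd1] := meval_unif_continuous Q (ltW Bv0) nv0.
have B1 : 0 < B + 1 by rewrite addr_gt0.
(* Since [d2 <= 1], the coordinates of [u'] are at most [B + 1]. A root [t] with [|t| > M] would
   make [Q] vanish at [v + u' / t], which is within [d1] of [v], where [Q] is nonzero. *)
pose M := (B + 1) / d1; have M0 : 0 < M by rewrite divr_gt0.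
have h0 : 0 < `|meval v Q| * eps ^+ n by rewrite mulr_gt0 ?exprn_gt0.
have BM0 : 0 <= B + 1 + Bv * M.
  by apply: addr_ge0; [|apply: mulr_ge0]; apply: ltW.
have [d2 /andP[d20 d21] hd2] := meval_unif_continuous Q BM0 h0.
exists d2 => // u' hu' t; rewrite root_linepoly => /eqP ht.
have hB' j : `|u' j| <= B + 1.
  rewrite -[u' j](subKr (u j)); apply: le_trans (ler_normB _ _) _.
  by rewrite lerD//; apply: le_trans (hu' j) d21.
have tM : `|t| <= M.
  have [//|Mt] := real_leP (normr_real t) (gtr0_real M0).
  have t0 : t != 0 by rewrite -normr_gt0 (lt_trans M0).
  have : `|meval v Q - meval (fun j => v j + u' j * t^-1) Q| < `|meval v Q|.
    apply: hd1 => // j.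
    rewrite opprD addrA subrr sub0r normrN normrM normfV.
    rewrite ler_pdivrMr ?normr_gt0//; apply: le_trans (hB' j) _.
    by rewrite mulrC -ler_pdivrMr// ltW.
  have -> : meval (fun j => v j + u' j * t^-1) Q = 0; last by rewrite subr0 ltxx.
  apply: (mulfI (expf_neq0 n t0)); rewrite mulr0 -(meval_homog hQ) -ht.
  by apply: meval_eq => j; rewrite mulrDr mulrCA mulfV// mulr1 addrC mulrC.
apply: (linepoly_root_near hQ) => //.
have := hd2 (fun j => u' j + v j * t) (fun j => u j + v j * t).
rewrite ht sub0r normrN; apply=> j.
  apply: le_trans (ler_normD _ _) _; rewrite lerD//.
  by rewrite normrM ler_pM.
by rewrite opprD addrACA subrr addr0 distrC.
Qed.

Lemma complex_gt0E (R : rcfType) (z : R[i]) : 0 < z ->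
  exists2 x : R, 0 < x & z = (x%:C)%C.
Proof.
case: z => a b; rewrite ltcE /= => /andP[/eqP -> a0]; by exists a.
Qed.

Lemma seq_lt0_bounded (R : realDomainType) (T : eqType) (l : T -> R)
    (s : seq T) : {in s, forall x, l x < 0} ->
  exists2 eps : R, 0 < eps & {in s, forall x, l x <= - eps}.
Proof.
elim: s => [_|x s ih h]; first by exists 1.
have [eps e0 he] := ih (fun y hy => h y (mem_behead (hy : y \in behead (x :: s)))).
have lx := h x (mem_head _ _).
exists (Num.min eps (- l x)) => [|y]; first by rewrite lt_min e0 oppr_gt0.
rewrite inE lerNr ge_min => /predU1P[->|/he]; first by rewrite lexx orbT.
by rewrite lerNr => ->.
Qed.

(* If no root may cross the line [l = 0], the set of parameters all of whose
   roots satisfy [l < 0] is relatively open and closed. *)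
Lemma linepoly_roots_lt0 (R : realType) (d n : nat) (Q : mpoly d R[i])
    (v : 'I_d -> R[i]) (T : topologicalType) (A : set T)
    (w : T -> 'I_d -> R[i]) (l : R[i] -> R) (a : T) :
  Q \is ishomog1 n (@mdeg d) -> meval v Q != 0 -> connected A ->
  (forall (t : T) (delta : R), 0 < delta ->
    \forall s \near t, forall j, `|w t j - w s j| <= (delta%:C)%C) ->
  (forall x y : R[i], ((l x - l y)%:C)%C <= `|x - y|) ->
  (forall t, A t -> forall z, root (linepoly Q (w t) v) z -> l z != 0) ->
  A a -> (forall z, root (linepoly Q (w a) v) z -> l z < 0) ->
  forall t, A t -> forall z, root (linepoly Q (w t) v) z -> l z < 0.
Proof.
move=> hQ hv cA hw hl hA0 Aa ha.
pose U := [set t | forall z, root (linepoly Q (w t) v) z -> l z < 0].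
pose V := [set t | exists2 z, root (linepoly Q (w t) v) z & 0 < l z].
have oU : open U.
  rewrite openE => t Ut; rewrite /interior.
  have [rs _ hrs] := linepoly_factor hQ (w t) hv.
  have rsP z : root (linepoly Q (w t) v) z = (z \in rs).
    by rewrite hrs rootZ// root_prod_XsubC.
  have [|eps e0 he] := @seq_lt0_bounded _ _ l rs.
    by move=> z; rewrite -rsP; apply: Ut.
  have [|delta d0 hd] := linepoly_root_proj hQ (w t) hv (eps := (eps%:C)%C).
    by rewrite ltcR.
  have [x x0 dx] := complex_gt0E d0; rewrite dx in hd.
  apply: filterS (hw t x x0) => s hs z /(hd _ hs)[z'].
  rewrite rsP => /he hz' hz.
  have := le_lt_trans (hl _ _) hz; rewrite ltcR => hlz.
  lra.
have oV : open V.
  rewrite openE => t [z hz lz]; rewrite /interior.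
  have [|delta d0 hd] := linepoly_root_lift hQ hv (eps := ((l z)%:C)%C) _ hz.
    by rewrite ltcR.
  have [x x0 dx] := complex_gt0E d0; rewrite dx in hd.
  apply: filterS (hw t x x0) => s /hd[z' hz' zz']; exists z' => //.
  have := le_lt_trans (hl _ _) zz'; rewrite ltcR => hlz.
  lra.
(* On [A] no root has [l = 0], so failing [U] means having a root with [l > 0]; thus [U] is also
   relatively closed. *)
have AUV : A `&` U = A `&` ~` V.
  apply/seteqP; split => t [At ht]; split => //.
    by move=> [z /ht]; case: ltgtP.
  move=> z hz; have := hA0 t At z hz; rewrite neq_lt => /orP[//|lz].
  by case: ht; exists z.
suff UA : A `&` U = A by move=> t At; move: (At); rewrite -UA => -[].
apply: cA; first by exists a.
  by exists U.
exists (~` V) => //; exact: open_closedC.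
Qed.

(** * Garding's theorem *)

Lemma near_coord (R : realType) (d : nat) (x : 'rV[R]_d) (delta : R) :
  0 < delta ->
  \forall y \near x, forall j, `|x ord0 j - (y : 'rV[R]_d) ord0 j| <= delta.
Proof.
move=> d0; apply/nbhs_ballP; exists delta => //= y hy j.
have [_ /(_ ord0 j)] := hy; rewrite -ball_normE /= => h; exact: ltW h.
Qed.

Lemma open_cone_refl (R : realType) (d : nat) (f : 'rV[R]_d -> R)
    (e : 'rV[R]_d) : 0 < f e -> open_cone f e e.
Proof. by move=> e0; apply: connected_component_refl. Qed.

Lemma open_cone_segment (R : realType) (d : nat) (f : 'rV[R]_d -> R)
    (e x v : 'rV[R]_d) :
  open_cone f e x -> (forall t, 0 <= t <= 1 -> 0 < f (x + t *: v)) ->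
  open_cone f e (x + v).
Proof.
move=> ex h; apply: connected_component_trans ex _.
pose g (t : R) := x + t *: v.
have cg : connected (g @` `[0, 1]).
  apply: connected_continuous_connected; first exact: segment_connected.
  apply: continuous_subspaceT => t; apply: cvgD; first exact: cvg_cst.
  apply: cvgZl; exact: cvg_id.
have := @connected_component_max _ [set y | 0 < f y] _ x _ _ cg; apply.
- by exists 0; rewrite /g /= ?scale0r ?addr0// in_itv /= lexx ler01.
- by move=> _ [t /= /h ht <-].
by exists 1; rewrite /g /= ?scale1r// in_itv /= lexx ler01.
Qed.

Lemma homogeneous_map (R S : nzRingType) (f : {rmorphism R -> S}) (d n : nat)
    (P : mpoly d R) : injective f -> P \is ishomog1 n (@mdeg d) ->
  map_mpoly f P \is ishomog1 n (@mdeg d).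
Proof.
move=> fI /dhomogP h; apply/dhomogP => k.
by rewrite (perm_mem (msupp_map_mpoly P fI)); apply: h.
Qed.

Lemma meval_map (R S : comNzRingType) (f : {rmorphism R -> S}) (d : nat)
    (P : mpoly d R) (u : 'I_d -> R) : injective f ->
  meval (fun j => f (u j)) (map_mpoly f P) = f (meval u P).
Proof.
move=> fI; rewrite !mevalE (perm_big _ (msupp_map_mpoly P fI)) rmorph_sum.
apply: eq_bigr => k _; rewrite mcoeff_map_mpoly rmorphM rmorph_prod.
by congr (_ * _); apply: eq_bigr => j _; rewrite rmorphXn.
Qed.

Section ComplexLines.
Variables (R : realType) (d n : nat) (P : mpoly d R).
Hypothesis hhom : homogeneous n P.

Let PC := map_mpoly (real_complex R) P.
Let cv (x : 'rV[R]_d) : 'I_d -> R[i] := fun j => real_complex R (x ord0 j).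

Let hhomC : PC \is ishomog1 n (@mdeg d).
Proof. exact: homogeneous_map (@complexI R) hhom. Qed.

Lemma meval_cv x : meval (cv x) PC = real_complex R (polyfun P x).
Proof. exact: (meval_map _ _ (@complexI R)). Qed.

Lemma polyfunZ (a : R) (x : 'rV[R]_d) :
  polyfun P (a *: x) = a ^+ n * polyfun P x.
Proof.
by rewrite /polyfun -(meval_homog hhom); apply: meval_eq => j; rewrite !mxE.
Qed.

Lemma hyperbolic_root e x z : hyperbolic P e ->
  root (linepoly PC (cv x) (cv e)) z -> complex.Im z = 0.
Proof.
(* The imaginary part in [hyperbolic] is complex-valued, whereas [complex.Im] is real-valued. *)
move=> [_ h]; rewrite root_linepoly => /eqP hz; apply: (@complexI R).
rewrite complexIm; apply: (h x).
by rewrite -hz; apply: meval_eq => j; rewrite mulrC.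
Qed.

Lemma meval_cv_neq0 e : 0 < polyfun P e -> meval (cv e) PC != 0.
Proof. by move=> h; rewrite meval_cv (inj_eq (@complexI R) _ 0) gt_eqF. Qed.

Lemma near_cv (x : 'rV[R]_d) (delta : R) : 0 < delta ->
  \forall y \near x, forall j, `|cv x j - cv y j| <= real_complex R delta.
Proof.
move=> /(near_coord x); apply: filterS => y h j.
by rewrite -rmorphB normc_def /= expr0n addr0 sqrtr_sqr lecR.
Qed.

Lemma ReB_le_norm (x y : R[i]) :
  real_complex R (complex.Re x - complex.Re y) <= `|x - y|.
Proof.
rewrite -raddfB; apply: le_trans (normc_ge_Re _); rewrite lecR; exact: ler_norm.
Qed.

Lemma ImB_le_norm (x y : R[i]) :
  real_complex R (complex.Im x - complex.Im y) <= `|x - y|.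
Proof.
rewrite -raddfB normc_def lecR; apply: le_trans (ler_norm _) _.
by rewrite -sqrtr_sqr ler_wsqrtr// lerDr sqr_ge0.
Qed.

(** The roots are real and none is [0] because [p > 0] on the cone; so no real part vanishes as the
    base point moves through the connected cone, starting from [e]. *)
Lemma hyperbolic_cone_root e x : hyperbolic P e -> open_cone (polyfun P) e x ->
  forall z, root (linepoly PC (cv x) (cv e)) z -> complex.Re z < 0.
Proof.
move=> he ex; have e0 := he.1.
have := @linepoly_roots_lt0 R d n PC (cv e) _ (open_cone (polyfun P) e) cv
  (@complex.Re R) e hhomC (meval_cv_neq0 e0)
  (@component_connected _ _ _) near_cv
  ReB_le_norm.
move=> h; apply: h ex => //.
- move=> y /connected_component_sub /= y0 z hz.
  have := hyperbolic_root he hz; apply: contra_eqN => /eqP hRe.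
  apply/eqP => hIm; have z0 : z = 0 by case: (z) hRe hIm => a b /= -> ->.
  have := meval_cv_neq0 y0; move: hz; rewrite z0 root_linepoly.
  by under [meval _ _]meval_eq do rewrite mulr0 addr0; move=> ->.
- exact: open_cone_refl.
move=> z; rewrite root_linepoly => /eqP hz.
(* At the base point [e] the polynomial is [(1 + z)^n p(e)], whose only possible root is [-1]. *)
have : (1 + z) ^+ n * meval (cv e) PC = 0.
  by rewrite -(meval_homog hhomC) -[RHS]hz; apply: meval_eq => j;
    rewrite mulrDl mul1r mulrC.
move=> /eqP; rewrite mulf_eq0 (negPf (meval_cv_neq0 e0)) orbF expf_eq0.
rewrite addr_eq0 => /andP[_ /eqP h1].
have /(congr1 (@complex.Re R)) /= : z = -1 by rewrite h1 opprK.
by move=> ->; rewrite ltrN10.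
Qed.

(* Garding: for [e] in the cone, [p(s x + z e + i a e0)] with [a > 0] has no
   zero [z] on the real line, so its zeros stay in the lower half-plane, where
   they are for [s = 0], as [s] moves from [0] to [1]. *)
Lemma shifted_roots_lower (e0 e x : 'rV[R]_d) (a : R) :
  hyperbolic P e0 -> open_cone (polyfun P) e0 e -> 0 < a ->
  forall z, root (linepoly PC
    (fun j => cv x j + cv e0 j * (a *i)%C) (cv e)) z -> complex.Im z < 0.
Proof.
move=> h0 he a0; have e_gt0 : 0 < polyfun P e := connected_component_sub he.
pose w (s : R) j := real_complex R s * cv x j + cv e0 j * (a *i)%C.
suff h : forall s, `[0, 1]%classic s ->
    forall z, root (linepoly PC (w s) (cv e)) z -> complex.Im z < 0.
  move=> z hz; apply: (h 1); first by rewrite /= in_itv /= lexx ler01.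
  suff -> : w 1 = fun j => cv x j + cv e0 j * (a *i)%C by [].
  by apply/funext => j; rewrite /w rmorph1 mul1r.
have ia0 : (a *i)%C != 0 :> R[i] by rewrite eq_complex /= eqxx gt_eqF.
have h := @linepoly_roots_lt0 R d n PC (cv e) R `[0, 1]%classic w
  (@complex.Im R) 0 hhomC (meval_cv_neq0 e_gt0) (@segment_connected _ _ _)
  _ ImB_le_norm; apply: h.
- move=> t delta d0; have [B B0 hB] := family_bounded (fun j => x ord0 j).
  have dB : 0 < delta / B by rewrite divr_gt0.
  apply/nbhs_ballP; exists (delta / B) => //= s.
  rewrite -ball_normE /= => hs j.
  rewrite /w opprD addrACA subrr addr0 -mulrBl -rmorphB -rmorphM normc_def /=.
  rewrite expr0n addr0 sqrtr_sqr lecR normrM.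
  apply: le_trans (ler_pM (normr_ge0 _) (normr_ge0 _) (ltW hs) (hB j)) _.
  by rewrite divfK// gt_eqF.
- move=> t _ z; rewrite root_linepoly => hz; apply/eqP => z0.
  (* A real zero [z] would make the non-real number [i a] a root along [e0] at the real point
     [t x + z e]. *)
  have hr : root (linepoly PC (cv (t *: x + complex.Re z *: e)) (cv e0))
      (a *i)%C.
    rewrite root_linepoly -(eqP hz); apply/eqP; apply: meval_eq => j.
    rewrite /w /cv !mxE rmorphD !rmorphM /= addrAC.
    have -> : z = real_complex R (complex.Re z) by case: (z) z0 => ? ? /= ->.
    by rewrite /= [_ * real_complex R (complex.Re z)]mulrC.
  by have := hyperbolic_root h0 hr => /= /eqP; rewrite gt_eqF.
- by rewrite /= in_itv /= lexx ler01.
move=> z; rewrite root_linepoly => /eqP hz.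
have {}hz : meval (fun j => cv e0 j * (a *i)%C + cv e j * z) PC = 0.
  by rewrite -hz; apply: meval_eq => j; rewrite /w rmorph0 mul0r add0r.
have [z0|z0] := eqVneq z 0.
  have /eqP : (a *i)%C ^+ n * meval (cv e0) PC = 0.
    rewrite -(meval_homog hhomC) -[RHS]hz; apply: meval_eq => j.
    by rewrite z0 mulr0 addr0 mulrC.
  by rewrite mulf_eq0 expf_eq0 (negPf ia0) (negPf (meval_cv_neq0 h0.1)) andbF.
(* After division by [z], the number [i a / z] is a root of [p(e + t e0)], hence a negative real
   [r1]; so [Im z = a / r1 < 0]. *)
have hr : root (linepoly PC (cv e) (cv e0)) ((a *i)%C / z).
  rewrite root_linepoly; apply/eqP/(mulfI (expf_neq0 n z0)).
  rewrite mulr0 -(meval_homog hhomC) -[RHS]hz; apply: meval_eq => j.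
  by rewrite mulrDr addrC mulrCA [z * (_ / z)]mulrC divfK// [z * _]mulrC.
have := hyperbolic_root h0 hr; have := hyperbolic_cone_root h0 he hr.
have : (a *i)%C = (a *i)%C / z * z by rewrite divfK.
case: (_ / z) => r1 r2; case: (z) => b c /= -[_ ac] r10 r20.
rewrite r20 mul0r addr0 in ac.
by rewrite -(nmulr_rgt0 _ r10) -ac.
Qed.

(** Let [a] tend to [0] in [shifted_roots_lower]: a root in the upper half-plane would survive the
    small shift by [i a e0]. The symmetry [(x, z) -> (-x, -z)] excludes the lower half-plane. *)
Lemma hyperbolic_cone (e0 e : 'rV[R]_d) :
  hyperbolic P e0 -> open_cone (polyfun P) e0 e -> hyperbolic P e.
Proof.
move=> h0 he; have e_gt0 : 0 < polyfun P e := connected_component_sub he.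
have key x z : root (linepoly PC (cv x) (cv e)) z -> complex.Im z <= 0.
  move=> hz; rewrite leNgt; apply/negP => z0.
  have [|delta d0 hd] := linepoly_root_lift hhomC (meval_cv_neq0 e_gt0)
      (eps := real_complex R (complex.Im z)) _ hz.
    by rewrite ltcR.
  have [y y0 dy] := complex_gt0E d0; rewrite dy in hd.
  have [B B0 hB] := family_bounded (fun j => e0 ord0 j).
  (* With [a = y / B] each coordinate of the shift [i a e0] has modulus at most [y]. *)
  have yB : 0 < y / B by rewrite divr_gt0.
  have [j|z' hz'] := hd (fun j => cv x j + cv e0 j * ((y / B) *i)%C).
    rewrite opprD addrA subrr sub0r normrN normc_def /= lecR !mul0r !mulr0.
    rewrite subr0 addr0 expr0n add0r sqrtr_sqr normrM (gtr0_norm yB).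
    apply: le_trans (ler_wpM2r (ltW yB) (hB j)) _.
    by rewrite mulrCA divff ?mulr1// gt_eqF.
  have := shifted_roots_lower h0 he yB hz' => z'0 zz'.
  have := le_lt_trans (ImB_le_norm z z') zz'; rewrite ltcR => h.
  lra.
split=> // x z hz.
have hr : root (linepoly PC (cv x) (cv e)) z.
  rewrite root_linepoly -hz; apply/eqP; apply: meval_eq => j.
  by rewrite mulrC.
rewrite -complexIm; suff -> : complex.Im z = 0 by [].
apply/eqP; rewrite eq_le (key _ _ hr) /=.
suff /key : root (linepoly PC (cv (- x)) (cv e)) (- z).
  by rewrite raddfN oppr_le0.
have : (-1) ^+ n * meval (fun j => cv x j + cv e j * z) PC = 0.
  by move: hr; rewrite root_linepoly => /eqP ->; rewrite mulr0.
rewrite root_linepoly -(meval_homog hhomC) => <-; apply/eqP/meval_eq => j.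
by rewrite /cv mxE rmorphN mulN1r opprD mulrN.
Qed.
End ComplexLines.

(** * Concavity of the logarithm *)

(** Carried through the induction: the constant coefficient is independent of the direction and the
    next one is linear in it. Products preserve this by the Leibniz rule. *)
Lemma linepoly_coef1 (K : comNzRingType) (d : nat) (Q : mpoly d K)
    (u : 'I_d -> K) :
  exists g : 'I_d -> K, forall v, (linepoly Q u v)`_1 = \sum_j v j * g j.
Proof.
pose Pr (F : ('I_d -> K) -> {poly K}) := exists a : K, exists g : 'I_d -> K,
  forall v, (F v)`_0 = a /\ (F v)`_1 = \sum_j v j * g j.
suff [a [g hg]] : Pr (linepoly Q u) by exists g => v; apply: (hg v).2.
apply: (mmap_fun_ind (f := polyC)).
- move=> c; exists c, (fun=> 0) => v; rewrite !coefC/=; split=> //.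
  by rewrite big1 // => j _; rewrite mulr0.
- move=> j; exists (u j), (fun i => (i == j)%:R) => v.
  rewrite !coefD !coefC !coefCM !coefX /= mulr0 addr0 add0r mulr1; split=> //.
  rewrite (bigD1 j)//= eqxx mulr1 big1 ?addr0// => i /negPf ->.
  by rewrite mulr0.
- move=> F G [a [g hF]] [b [h hG]]; exists (a + b), (fun j => g j + h j) => v.
  have [F0 F1] := hF v; have [G0 G1] := hG v.
  rewrite !coefD F0 F1 G0 G1 -big_split; split=> //.
  by apply: eq_bigr => j _; rewrite mulrDr.
move=> F G [a [g hF]] [b [h hG]].
exists (a * b), (fun j => a * h j + g j * b) => v.
have [F0 F1] := hF v; have [G0 G1] := hG v.
rewrite !coefM !big_ord_recl !big_ord0 /= F0 F1 G0 G1 !addr0; split=> //.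
rewrite mulr_sumr mulr_suml -big_split; apply: eq_bigr => j _ /=.
ring.
Qed.

Lemma linepoly_map (R S : comNzRingType) (f : {rmorphism R -> S}) (d : nat)
    (P : mpoly d R) (u v : 'I_d -> R) : injective f ->
  linepoly (map_mpoly f P) (f \o u) (f \o v) = map_poly f (linepoly P u v).
Proof.
move=> fI; rewrite /linepoly /mmap (perm_big _ (msupp_map_mpoly P fI)) rmorph_sum.
apply: eq_bigr => k _; rewrite mcoeff_map_mpoly rmorphM /= map_polyC.
rewrite /mmap1 rmorph_prod; congr (_ * _); apply: eq_bigr => j _.
by rewrite rmorphXn rmorphD rmorphM /= !map_polyC map_polyX.
Qed.

Section RealLines.
Variables (R : realType) (d n : nat) (P : mpoly d R).
Hypotheses (n_gt0 : (0 < n)%N) (hhom : homogeneous n P).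

Let line (x v : 'rV[R]_d) : {poly R} := linepoly P (x ord0) (v ord0).

Lemma horner_line x v t : (line x v).[t] = polyfun P (x + t *: v).
Proof.
rewrite horner_linepoly; apply: meval_eq => j.
by rewrite !mxE mulrC.
Qed.

Lemma dirder_line i e x t :
  dirder i (polyfun P) e (x + t *: e) = ((line x e)^`(i)).[t].
Proof.
elim: i t => [|i ih] t; first by rewrite derivn0 horner_line.
rewrite derivnS derivE derive1E [LHS]/dirder iterS -/(dirder i (polyfun P) e).
rewrite /derive; set F := (X in X @ _); set G := (X in _ = lim (X @ _)).
(* By induction the two difference quotients are equal as functions of [h], hence so are their
   limits. *)
suff -> : F = G by [].
apply/funext => h; rewrite /F /G /= -ih -ih addrCA -scalerDl.
by rewrite [h%:A]mulr1.
Qed.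

(* [graddir e x] is [Dp(e)[x]]. *)
Definition graddir (e x : 'rV[R]_d) : R := (line e x)`_1.

Lemma graddir_is_linear e : linear (graddir e).
Proof.
have [g hg] := linepoly_coef1 P (e ord0).
move=> a x y; rewrite /graddir /line !hg scaler_sumr -big_split.
by apply: eq_bigr => j _; rewrite !mxE mulrDl -mulrA.
Qed.

(** The derivative is [(n-1)!] times the coefficient of [t^(n-1)] in [p(x + t e)], which by reversal
    is the coefficient of [t] in [p(e + t x)]. *)
Lemma dirder_pred e x :
  dirder n.-1 (polyfun P) e x = n.-1`!%:R * graddir e x.
Proof.
have := dirder_line n.-1 e x 0; rewrite scale0r addr0 => ->.
rewrite horner_coef0 coef_derivn addn0 ffactnn [RHS]mulr_natl; congr (_ *+ _).
rewrite /line (linepoly_rev hhom) ?leq_pred//; congr (_`_ _).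
by rewrite -[n in (n - _)%N](prednK n_gt0) subSnn.
Qed.

Lemma ln_le_subr1 (r : R) : 0 < r -> ln r <= r - 1 ?= iff (r == 1).
Proof.
move=> r0; split.
  have := @le_ln1Dx _ (r - 1); rewrite (_ : 1 + (r - 1) = r); last by ring.
  by apply; lra.
have [->|r1] := eqVneq r 1; first by rewrite ln1 subrr eqxx.
apply/negP => /eqP h; have : r - 1 != 0 by rewrite subr_eq0.
by move=> /expR_gt1Dx; rewrite -h lnK ?posrE// addrC h subrK ltxx.
Qed.

Lemma ln_prod_le (s : seq R) : {in s, forall r, 0 < r} ->
  ln (\prod_(r <- s) r) <= \sum_(r <- s) r - (size s)%:R ?= iff all (pred1 1) s.
Proof.
elim: s => [_|r s ih h].
  by rewrite !big_nil ln1 subr0; apply/leif_refl.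
have r0 : 0 < r by apply: h; rewrite mem_head.
have hs : {in s, forall r, 0 < r} by move=> y ys; apply: h; rewrite inE ys orbT.
have p0 : 0 < \prod_(r <- s) r by rewrite big_seq prodr_gt0.
rewrite !big_cons lnM ?posrE//= -natr1 opprD [- _ - 1]addrC addrACA.
exact: leifD (ln_le_subr1 r0) (ih hs).
Qed.

Lemma line_factor e x : hyperbolic P e -> open_cone (polyfun P) e x ->
  exists s : seq R, [/\ size s = n, {in s, forall r, 0 < r} &
    line x e = polyfun P e *: \prod_(r <- s) ('X + r%:P)].
Proof.
move=> he hx.
have [rs srs hrs] := linepoly_factor (homogeneous_map (@complexI R) hhom)
  (real_complex R \o x ord0) (meval_cv_neq0 he.1).
have hroot z : z \in rs -> root (linepoly (map_mpoly (real_complex R) P)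
    (real_complex R \o x ord0) (real_complex R \o e ord0)) z.
  by rewrite hrs rootZ ?(meval_cv_neq0 he.1)// root_prod_XsubC.
exists [seq - complex.Re z | z <- rs]; split; first by rewrite size_map.
  move=> _ /mapP[z /hroot hz ->]; rewrite oppr_gt0.
  exact: (hyperbolic_cone_root hhom he hx).
have mI := map_poly_inj (real_complex R); apply: mI.
rewrite -linepoly_map; last exact: complexI.
rewrite hrs map_polyZ /= meval_cv big_map rmorph_prod; congr (_ *: _).
rewrite big_seq [RHS]big_seq; apply: eq_bigr => z hz.
rewrite rmorphD /= map_polyX map_polyC -polyCN; congr (_ + _%:P).
have := hyperbolic_root he (hroot z hz); case: (z) => a b /= ->.
by apply/eqP; rewrite eq_complex /= oppr0 !eqxx.
Qed.

(** The members of [s] are the eigenvalues of [x] relative to [e], the negated roots of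
    [p(x + t e)]: their product gives [p(x)], their sum the gradient term. *)
Lemma line_eigenvalues e x : hyperbolic P e -> open_cone (polyfun P) e x ->
  exists s : seq R, [/\ size s = n, {in s, forall r, 0 < r},
    (forall t, polyfun P (x + t *: e) = polyfun P e * \prod_(r <- s) (t + r)),
    polyfun P x = polyfun P e * \prod_(r <- s) r
  & graddir e x = polyfun P e * \sum_(r <- s) r].
Proof.
move=> he hx; have [s [ss s0 hs]] := line_factor he hx.
have ht t : polyfun P (x + t *: e) = polyfun P e * \prod_(r <- s) (t + r).
  rewrite -horner_line hs hornerZ horner_prod; congr (_ * _).
  by apply: eq_bigr => r _; rewrite !hornerE.
exists s; split=> //.
  rewrite -[X in polyfun P X](addr0 x) -(scale0r e) ht; congr (_ * _).
  by apply: eq_bigr => r _; rewrite add0r.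
(* After reversal this is the coefficient of [t^(n-1)] in [p(x + t e)], given by Vieta. *)
rewrite /graddir /line (linepoly_rev hhom)// subn1 -/(line x e) hs coefZ.
have -> : \prod_(r <- s) ('X + r%:P) =
          \prod_(r <- map -%R s) ('X - r%:P).
  by rewrite big_map; apply: eq_bigr => r _; rewrite polyCN opprK.
have -> : n.-1 = (size (map -%R s)).-1 by rewrite size_map ss.
rewrite coefPn_prod_XsubC ?size_map ?ss -?lt0n// big_map sumrN opprK.
by [].
Qed.

(** Euler's identity. All eigenvalues of [e] relative to itself are [1], since
    [p((1 - r) e) = (1 - r)^n p(e)]. *)
Lemma graddir_self e : hyperbolic P e -> graddir e e = n%:R * polyfun P e.
Proof.
move=> he; have ee : open_cone (polyfun P) e e.
  exact: open_cone_refl he.1.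
have [s [ss s0 ht _ ->]] := line_eigenvalues he ee.
rewrite mulrC; congr (_ * _).
rewrite (_ : \sum_(r <- s) r = \sum_(r <- s) 1); last first.
  rewrite big_seq [RHS]big_seq; apply: eq_bigr => r rs.
  have : polyfun P (e + - r *: e) = 0.
    rewrite ht (perm_big _ (perm_to_rem rs)) big_cons /=.
    by rewrite addNr mul0r mulr0.
  rewrite -[X in X + _]scale1r -scalerDl (polyfunZ hhom) => /eqP.
  by rewrite mulf_eq0 expf_eq0 (gt_eqF he.1) orbF subr_eq0 => /andP[_ /eqP ->].
by rewrite big_const_seq count_predT ss iter_addr_0.
Qed.

(* Both [ln p(x) <= ln p(e) + D(ln p)(e)[x - e]] on the cone and its equality
   case follow from [ln r <= r - 1] at the eigenvalues of [x]. *)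
Lemma ln_polyfun_leif e x : hyperbolic P e -> open_cone (polyfun P) e x ->
  ln (polyfun P x) <= ln (polyfun P e) + graddir e (x - e) / polyfun P e
    ?= iff `[< forall t, polyfun P (x + t *: e) = (t + 1) ^+ n * polyfun P e >].
Proof.
move=> he hx; have e0 := he.1.
have [s [ss s0 ht px gx]] := line_eigenvalues he hx.
have s0' : 0 < \prod_(r <- s) r by rewrite big_seq prodr_gt0.
have lnE : ln (polyfun P x) = ln (polyfun P e) + ln (\prod_(r <- s) r).
  by rewrite px lnM ?posrE.
have gE : graddir e (x - e) / polyfun P e = \sum_(r <- s) r - (size s)%:R.
  rewrite -[x - e]addrC -scaleN1r graddir_is_linear gx graddir_self// ss.
  by rewrite scaleN1r; field; rewrite gt_eqF.
have := ln_prod_le s0; rewrite lnE gE => h.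
rewrite (_ : `[< _ >] = all (pred1 1) s).
  by rewrite /Order.leif lerD2l (inj_eq (addrI _)).
(* At [t = -r] the left side vanishes, which forces [(1 - r)^n = 0]. *)
apply/asboolP/allP => [h1 r rs|h1 t].
  have := h1 (- r); rewrite ht (perm_big _ (perm_to_rem rs)) big_cons /=.
  rewrite addNr mul0r mulr0 => /esym/eqP; rewrite mulf_eq0 expf_eq0 (gt_eqF e0) orbF.
  by rewrite addrC subr_eq0 eq_sym => /andP[].
rewrite ht mulrC; congr (_ * _); rewrite (eq_big_seq (fun=> t + 1)).
  by rewrite big_const_seq count_predT ss iter_mulr mulr1.
by move=> r /h1 /eqP ->.
Qed.

End RealLines.

(** * Linear programs with one inequality *)

HB.instance Definition _ (R : realType) (d : nat) (P : mpoly d R)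
    (e : 'rV[R]_d) :=
  GRing.isLinear.Build R 'rV[R]_d R *%R (graddir P e) (graddir_is_linear P e).

Lemma closure_ray (R : realType) (d : nat) (S : set 'rV[R]_d)
    (x v : 'rV[R]_d) : (forall t, 0 < t -> S (x + t *: v)) -> closure S x.
Proof.
move=> h B hB.
have : (fun t : R => x + t *: v) @ (0 : R)^'+ --> x.
  apply: cvg_at_right_filter.
  rewrite -[X in _ --> X]addr0 -(scale0r v).
  by apply: cvgD; [exact: cvg_cst | apply: cvgZl; exact: cvg_id].
move=> /(_ B hB) hBt.
have : \forall t \near (0 : R)^'+, B (x + t *: v) /\ 0 < t.
  by apply: filterI => //; exact: nbhs_right_gt.
by move=> /filter_ex[t [Bt t0]]; exists (x + t *: v); split => //; apply: h.
Qed.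

Lemma scalar_continuous (R : realType) (d : nat) (f : {scalar 'rV[R]_d}) :
  continuous f.
Proof.
have -> : (f : _ -> _) = fun x : 'rV[R]_d => \sum_j x ord0 j * f (delta_mx 0 j).
  apply/funext => x; rewrite {1}[x]row_sum_delta linear_sum.
  by apply: eq_bigr => j _; rewrite linearZ.
apply: continuous_big; first exact: add_continuous.
move=> j _ x.
apply: (@continuousM R _ (fun y : 'rV[R]_d => y ord0 j)
  (fun=> f (delta_mx 0 j))); first exact: coord_continuous.
exact: cst_continuous.
Qed.

(** Continuity of [f] gives one inclusion. For the other, [x] is a limit of the points [x + t e],
    which are joined to [e] by segments in the open half-space. The factor [k] accommodates
    [(n-1)!]. *)
Lemma closed_cone_scalar (R : realType) (d : nat) (k : R)
    (f : {scalar 'rV[R]_d}) (e : 'rV[R]_d) : 0 < k -> 0 < f e ->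
  closed_cone (fun x => k * f x) e = [set x | 0 <= f x].
Proof.
move=> k0 fe0; apply/seteqP; split => x /=.
  move=> hx; rewrite leNgt; apply/negP => fx.
  have [y [hy fy]] := hx _ (cvgr_lt _ (@scalar_continuous R d f x) _ fx).
  have /= := connected_component_sub hy.
  by rewrite pmulr_rgt0// => /(lt_trans fy); rewrite ltxx.
move=> fx; apply: (@closure_ray _ _ _ _ e) => t t0.
have kfe : 0 < k * f e by rewrite mulr_gt0.
rewrite (_ : x + t *: e = e + (x + t *: e - e)); last by rewrite [RHS]addrC subrK.
apply: open_cone_segment; first exact: open_cone_refl.
move=> s /andP[s0 s1]; rewrite mulr_gt0//.
have -> : f (e + s *: (x + t *: e - e)) = (1 - s) * f e + s * (f x + t * f e).
  by rewrite linearD linearZ /= linearB linearD linearZ /=; ring.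
move: s0; rewrite le0r => /predU1P[->|s0]; first by rewrite subr0 mul1r mul0r addr0.
apply: ltr_wpDl; first by rewrite mulr_ge0 ?subr_ge0// ltW.
by rewrite mulr_gt0// ltr_wpDl// mulr_gt0.
Qed.

(** Applied to [v] and [-v], the first hypothesis makes [c] vanish wherever [f] does on [ker A], so
    [c] is a multiple of [f] there; [v0] or [-v0] shows that the factor is positive. *)
Lemma linear_form_proportional (K : realFieldType) (U W : lmodType K)
    (A : {linear U -> W}) (c f : {scalar U}) :
  (forall v, A v = 0 -> 0 <= f v -> 0 <= c v) ->
  (exists2 v, A v = 0 & c v != 0) ->
  exists2 a : K, 0 < a & forall v, A v = 0 -> c v = a * f v.
Proof.
move=> h [v0 Av0 cv0].
have h0 v : A v = 0 -> f v = 0 -> c v = 0.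
  move=> Av fv; apply/eqP; rewrite eq_le h ?fv// andbT.
  by rewrite -oppr_ge0 -linearN h ?linearN /= ?Av ?fv ?oppr0.
have fv0 : f v0 != 0 by apply: contra cv0 => /eqP /(h0 _ Av0) ->.
exists (c v0 / f v0).
  have [fv0_gt|fv0_lt|fv0_eq] := ltgtP 0 (f v0).
  - by rewrite divr_gt0// lt_neqAle eq_sym cv0 h// ltW.
  - rewrite nmulr_rgt0 ?invr_lt0//.
    rewrite -oppr_gt0 -linearN lt_neqAle eq_sym linearN oppr_eq0 cv0 /=.
    by rewrite -linearN h ?linearN /= ?Av0 ?oppr0// oppr_ge0 ltW.
  - by rewrite -fv0_eq eqxx in fv0.
move=> v Av; apply/eqP; rewrite -subr_eq0; apply/eqP.
have <- : c (v - (f v / f v0) *: v0) = c v - c v0 / f v0 * f v.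
  by rewrite linearB linearZ /=; field.
apply: h0; first by rewrite linearB linearZ /= Av Av0 scaler0 subr0.
by rewrite linearB linearZ /= divfK// subrr.
Qed.

(** If [c] vanished on [ker A], its composite with any section of [A] would be independent of the
    section, hence linear, and [c] would factor through [A]. *)
Lemma scalar_factor (K : fieldType) (U W : lmodType K) (A : {linear U -> W})
    (c : {scalar U}) : (forall y, exists x, A x = y) ->
  ~ (exists y : {scalar W}, forall x, c x = y (A x)) ->
  exists2 v, A v = 0 & c v != 0.
Proof.
move=> hA hc; apply: contrapT => h; apply: hc.
have c0 v : A v = 0 -> c v = 0.
  by move=> Av; apply/eqP; apply: contrapT => /negP cv; apply: h; exists v.
have cE x x' : A x = A x' -> c x = c x'.
  move=> Axx'; apply/eqP; rewrite -subr_eq0 -linearB; apply/eqP/c0.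
  by rewrite linearB /= Axx' subrr.
pose g y := projT1 (cid (hA y)).
have gE y : A (g y) = y by rewrite /g; case: cid.
have lin : scalar (c \o g).
  move=> a y z /=; rewrite -linearP; apply: cE.
  by rewrite linearP !gE.
pose y : {scalar W} := HB.pack (c \o g) (GRing.isLinear.Build _ _ _ _ _ lin).
by exists y => x /=; apply: cE; rewrite gE.
Qed.

(** * The central path *)

Lemma open_cone_line (R : realType) (d : nat) (P : mpoly d R)
    (e0 e v : 'rV[R]_d) : open_cone (polyfun P) e0 e ->
  exists2 delta : R, 0 < delta & forall t, `|t| < delta ->
    open_cone (polyfun P) e0 (e + t *: v).
Proof.
move=> he; have e_gt0 : 0 < polyfun P e := connected_component_sub he.
pose q := linepoly P (e ord0) (v ord0).
have q0 : 0 < q.[0] by rewrite horner_line scale0r addr0.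
have [delta /= d0 hd] : \forall t \near (0 : R), 0 < q.[t].
  exact: (cvgr_gt _ (@continuous_horner R q 0) _ q0).
exists delta => // t td; apply: open_cone_segment => // s /andP[s0 s1].
rewrite scalerA -horner_line; apply: hd; rewrite /= sub0r normrN normrM.
by apply: le_lt_trans td; rewrite ler_piMl// ger0_norm.
Qed.

Lemma open_coneZ (R : realType) (d n : nat) (P : mpoly d R)
    (e0 e : 'rV[R]_d) (t : R) : homogeneous n P -> 0 < t ->
  open_cone (polyfun P) e0 e -> open_cone (polyfun P) e0 (t *: e).
Proof.
move=> hhom t0 he; have e_gt0 : 0 < polyfun P e := connected_component_sub he.
rewrite (_ : t *: e = e + (t - 1) *: e); last first.
  by rewrite -{2}[e]scale1r -scalerDl addrC subrK.
apply: open_cone_segment => // s /andP[s0 s1].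
rewrite scalerA -{1}[e]scale1r -scalerDl (polyfunZ hhom) mulr_gt0// exprn_gt0//.
nra.
Qed.

Section CentralPath.
Variables (R : realType) (d m n : nat) (P : mpoly d R) (e0 : 'rV[R]_d).
Variables (A : {linear 'rV[R]_d -> 'rV[R]_m}) (b : 'rV[R]_m).
Variable c : {scalar 'rV[R]_d}.
Hypotheses (n_gt0 : (0 < n)%N) (hhom : homogeneous n P) (hhyp : hyperbolic P e0).

(** The first-order condition along the line [e + t v], which stays feasible for small [|t|]. *)
Lemma central_point_stationary eta e v : central_point P e0 A b c eta e ->
  A v = 0 -> eta * c v = graddir P e v / polyfun P e.
Proof.
move=> [[he Ae] emin] Av.
have e_gt0 : 0 < polyfun P e := connected_component_sub he.
have [delta d0 hd] := open_cone_line v he.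
pose q := linepoly P (e ord0) (v ord0).
have qE t : q.[t] = polyfun P (e + t *: v) by rewrite horner_line.
(* The objective on the line without the constant [eta * c e]. *)
pose phi : R -> R := horner ((eta * c v) *: 'X) - (@ln R \o horner q).
have phiE t : phi t = t * (eta * c v) - ln (polyfun P (e + t *: v)).
  by rewrite -qE mulrC -[X in _ * X - _]hornerX -hornerZ.
have hphi t : `|t| < delta ->
    is_derive t (1 : R) phi (eta * c v - (q.[t])^-1 * q^`().[t]).
  move=> td; have qt : 0 < q.[t].
    by rewrite qE; exact: (connected_component_sub (hd t td)).
  apply: is_deriveB; last exact: is_derive1_comp (is_derive1_ln qt) _.
  have := @is_derive_poly R ((eta * c v) *: 'X) t.
  by rewrite derivZ derivX hornerZ hornerC mulr1.
have inI t : t \in `]- delta, delta[ -> `|t| < delta.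
  by rewrite in_itv /= ltr_norml.
have : is_derive (0 : R) (1 : R) phi 0.
  apply: (@derive1_at_min _ phi (- delta) delta 0).
  - by rewrite ge0_cp ?ltW.
  - by move=> t /inI /hphi [].
  - by rewrite in_itv /= d0 oppr_lt0 d0.
  move=> t /inI td; rewrite !phiE scale0r addr0 mul0r sub0r.
  have := emin (e + t *: v) (conj (hd t td) _).
  rewrite !linearD !linearZ /= Av scaler0 addr0 => /(_ Ae); nra.
move=> h0; have := hphi 0; rewrite normr0 => /(_ d0) h1.
have := @derive_val _ _ _ _ _ _ _ h0; rewrite (@derive_val _ _ _ _ _ _ _ h1).
move=> /eqP; rewrite subr_eq0 => /eqP ->.
by rewrite qE scale0r addr0 mulrC horner_coef0 coef_deriv.
Qed.

(** Stationarity suffices by the tangent inequality [ln_polyfun_leif], available because [p] is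
    hyperbolic along [e] itself. *)
Lemma central_pointP eta e : central_point P e0 A b c eta e <->
  [/\ open_cone (polyfun P) e0 e, A e = b &
    forall v, A v = 0 -> eta * c v = graddir P e v / polyfun P e].
Proof.
split=> [he|[he Ae hgrad]].
  have [[he0 Ae] _] := he; split=> // v.
  exact: central_point_stationary.
split=> // y [hy Ay].
have heh := hyperbolic_cone hhom hhyp he.
have Aye : A (y - e) = 0 by rewrite linearB /= Ay Ae subrr.
have hey : open_cone (polyfun P) e y.
  exact: connected_component_trans (connected_component_sym he) hy.
have [+ _] := ln_polyfun_leif n_gt0 hhom heh hey.
by rewrite -hgrad// linearB /= mulrBr; lra.
Qed.

Lemma SwathP e : (exists2 v, A v = 0 & c v != 0) ->
  Swath P e0 A b c n.-1 e <->
  [/\ open_cone (polyfun P) e0 e, A e = b &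
    exists2 a : R, 0 < a & forall v, A v = 0 -> c v = a * graddir P e v].
Proof.
move=> hv.
suff h : open_cone (polyfun P) e0 e -> A e = b ->
    Opt P A b c n.-1 e !=set0 <->
    exists2 a : R, 0 < a & forall v, A v = 0 -> c v = a * graddir P e v.
  by split=> -[he Ae /(h he Ae)].
move=> he Ae; have heh := hyperbolic_cone hhom hhyp he.
have gee : 0 < graddir P e e.
  by rewrite (graddir_self n_gt0 hhom heh) mulr_gt0 ?heh.1// ltr0n.
have -> : Opt P A b c n.-1 e =
    minimizers c [set x | A x = b /\ 0 <= graddir P e x].
  rewrite /Opt.
  have -> : dirder n.-1 (polyfun P) e = fun x => n.-1`!%:R * graddir P e x.
    by apply/funext => x; rewrite (dirder_pred n_gt0 hhom).
  by rewrite closed_cone_scalar// ltr0n fact_gt0.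
split=> [[x [[Ax gx] xmin]]|[a a0 ha]].
  (* Such a [v] is a recession direction of the feasible set: [x + v] is again feasible. *)
  apply: linear_form_proportional hv => v Av gv.
  have := xmin (x + v); rewrite [c (x + v)]linearD lerDl; apply.
  by rewrite /= !linearD /= Av addr0 addr_ge0.
have [v0 Av0 cv0] := hv.
have gv0 : graddir P e v0 != 0.
  by apply: contra cv0 => /eqP gv0; rewrite ha// gv0 mulr0.
(* The point [e] is moved along [v0] onto the boundary hyperplane; all its feasible points are
   optimal, as [c (y - x)] is [a] times [graddir P e y]. *)
pose x := e - (graddir P e e / graddir P e v0) *: v0.
have gx : graddir P e x = 0 by rewrite /x linearB linearZ /= divfK// subrr.
have Ax : A x = b by rewrite /x linearB linearZ /= Av0 scaler0 subr0.
exists x; split=> [|y [Ay gy]]; first by rewrite /= gx.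
rewrite -subr_ge0 -linearB ha; last by rewrite linearB /= Ay Ax subrr.
by rewrite linearB /= gx subr0 mulr_ge0// ltW.
Qed.

Lemma central_point_unique eta : 0 < eta ->
  regular_cone (closed_cone (polyfun P) e0) ->
  is_subset1 (central_point P e0 A b c eta).
Proof.
move=> eta0 [_ hreg] x y hx hy.
have [hx0 Ax gx] := (central_pointP eta x).1 hx.
have [hy0 Ay _] := (central_pointP eta y).1 hy.
have hxh := hyperbolic_cone hhom hhyp hx0.
have hxy : open_cone (polyfun P) x y.
  exact: connected_component_trans (connected_component_sym hx0) hy0.
have /asboolP hpow : `[< forall t,
    polyfun P (y + t *: x) = (t + 1) ^+ n * polyfun P x >].
  (* Both points are minimizers, so their objective values agree; with stationarity at [x] this is
     equality in the tangent inequality. *)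
  have [_ <-] := ln_polyfun_leif n_gt0 hhom hxh hxy.
  rewrite -gx; last by rewrite linearB /= Ax Ay subrr.
  have h1 := hx.2 y hy.1; have h2 := hy.2 x hx.1.
  rewrite linearB /= mulrBr; apply/eqP; lra.
pose v := y - x.
have pv s : polyfun P (x + s *: v) = polyfun P x.
  have [->|s0] := eqVneq s 0; first by rewrite scale0r addr0.
  (* Hence the value is [s^n ((1 - s) / s + 1)^n p(x)], where the powers cancel. *)
  have -> : x + s *: v = s *: (y + ((1 - s) / s) *: x).
    by apply/rowP => j; rewrite /v !mxE; field.
  rewrite (polyfunZ hhom) hpow mulrA -exprMn.
  by rewrite (_ : s * _ = 1) ?expr1n ?mul1r//; field.
have cv s : open_cone (polyfun P) e0 (x + s *: v).
  apply: open_cone_segment => // t _; rewrite scalerA pv.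
  exact: connected_component_sub hx0.
suff : v \in 0%VS by rewrite memv0 subr_eq0 => /eqP.
rewrite -(hreg <[v]>%VS) ?memv_line// => _ /vlineP[k ->].
(* Every multiple [k v] is the limit of [k v + t x = t (x + (k / t) v)], a positive multiple of a
   point of the line. *)
apply: (@closure_ray _ _ _ _ x) => t t0.
have -> : k *: v + t *: x = t *: (x + (k / t) *: v).
  by apply/rowP => j; rewrite !mxE; field; rewrite gt_eqF.
exact: (open_coneZ hhom t0 (cv _)).
Qed.

End CentralPath.

Theorem theorem2 (R : realType) (d m n : nat)
    (P : mpoly d R) (e0 : 'rV[R]_d)
    (A : {linear 'rV[R]_d -> 'rV[R]_m}) (b : 'rV[R]_m)
    (c : {scalar 'rV[R]_d})
    (hn : (0 < n)%N)
    (hhom : homogeneous n P)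
    (hhyp : hyperbolic P e0)
    (hreg : regular_cone (closed_cone (polyfun P) e0))
    (hA : forall y : 'rV[R]_m, exists x : 'rV[R]_d, A x = y)
    (hb : b != 0)
    (hc : ~ exists y : {scalar 'rV[R]_m}, forall x : 'rV[R]_d, c x = y (A x)) :
  (forall eta : R, 0 < eta -> is_subset1 (central_point P e0 A b c eta)) /\
  Swath P e0 A b c n.-1 =
    \bigcup_(eta in [set eta : R | 0 < eta]) central_point P e0 A b c eta.
Proof.
split=> [eta eta0|]; first exact: (central_point_unique hn hhom).
have hv := scalar_factor hA hc.
apply/seteqP; split=> [e|e [eta /= eta0]].
  move=> /(SwathP b hn hhom hhyp e hv)[he Ae [a a0 ha]].
  have pe : 0 < polyfun P e := connected_component_sub he.
  (* The parameters are related by [eta * a * p(e) = 1], from comparing [c = a Dp(e)] with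
     [eta c = Dp(e) / p(e)] on [ker A]. *)
  exists (a * polyfun P e)^-1; first by rewrite /= invr_gt0 mulr_gt0.
  apply/(central_pointP A b c hn hhom hhyp); split=> // v /ha ->.
  by field; rewrite !gt_eqF.
move=> /(central_pointP A b c hn hhom hhyp)[he Ae hgrad].
have pe : 0 < polyfun P e := connected_component_sub he.
apply/(SwathP b hn hhom hhyp e hv); split=> //.
exists (eta * polyfun P e)^-1; first by rewrite invr_gt0 mulr_gt0.
move=> v /hgrad h; apply: (mulfI (lt0r_neq0 eta0)); rewrite h.
by field; rewrite !gt_eqF.
Qed.
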